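(* For $k\in\{1,2,3\}$, let $\Phi^{(4,k)}:M_4\to M_4$ be defined by $\Phi^{(4,k)}([a_{ij}])=\operatorname{diag}(b_1,\dots,b_4)-[a_{ij}]$ with $b_i=3a_{ii}+a_{\sigma_k(i),\sigma_k(i)}$, where $\sigma_k(i)\equiv i+k\pmod 4$, $\sigma_k(i)\in\{1,2,3,4\}$. Then $\Phi^{(4,k)}$ is an extremal positive linear map if and only if $k=1$ or $k=3$.
   Context: A linear map $\phi:M_n\to M_n$ is positive if it maps positive semidefinite matrices to positive semidefinite matrices. A positive linear map $\phi$ is extremal if whenever $\phi=\phi_1+\phi_2$ with $\phi_1,\phi_2$ positive linear maps, there are nonnegative reals $\lambda_i$ with $\phi_i=\lambda_i\phi$. *)

(* Defs.v *)
From mathcomp Require Import all_boot all_algebra reals.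
From mathcomp Require Import complex.
Set Implicit Arguments. Unset Strict Implicit. Unset Printing Implicit Defensive.
Import GRing.Theory Num.Theory.
Local Open Scope ring_scope.

Section Defs.
Variable R : realType.
Local Notation C := R[i].

Definition adjmx m n (A : 'M[C]_(m, n)) : 'M[C]_(n, m) := (map_mx Num.conj A)^T.

(* nonnegativity 0 <= x in C = R[i] means x is real and >= 0 *)
Definition psd n (A : 'M[C]_n) : Prop :=
  adjmx A = A /\ forall v : 'cV[C]_n, 0 <= (adjmx v *m A *m v) 0 0.

Definition is_linear_map n (f : 'M[C]_n -> 'M[C]_n) : Prop :=
  forall (a : C) (A B : 'M[C]_n), f (a *: A + B) = a *: f A + f B.

Definition positive_map n (f : 'M[C]_n -> 'M[C]_n) : Prop :=
  is_linear_map f /\ forall A, psd A -> psd (f A).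

Definition extremal_map n (f : 'M[C]_n -> 'M[C]_n) : Prop :=
  positive_map f /\
  forall f1 f2 : 'M[C]_n -> 'M[C]_n,
    positive_map f1 -> positive_map f2 ->
    (forall A, f A = f1 A + f2 A) ->
    exists l1 l2 : C, [/\ 0 <= l1, 0 <= l2,
      (forall A, f1 A = l1 *: f A) & (forall A, f2 A = l2 *: f A)].

Definition sigma (k : nat) (i : 'I_4) : 'I_4 := inord ((i + k) %% 4).

Definition Phi4 (k : nat) (A : 'M[C]_4) : 'M[C]_4 :=
  diag_mx (\row_i (3 * A i i + A (sigma k i) (sigma k i))) - A.

End Defs.

(* Main.v *)
Require Import Defs.
From mathcomp Require Import all_boot all_order all_algebra reals.
From mathcomp Require Import complex.
From mathcomp Require Import ring lra.
Import Order.TTheory GRing.Theory Num.Theory.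
Set Implicit Arguments. Unset Strict Implicit. Unset Printing Implicit Defensive.
Local Open Scope ring_scope.

(**
Let s be the 4-cycle of k = 1 and write c i j k l for the (k, l) entry of the
image of the matrix unit E_ij. Positivity of Phi reduces, through
|a_ij|^2 <= a_ii a_jj, to sum_i x_i^2 / (3 x_i^2 + x_(s i)^2) <= 1.

If f is a positive summand of Phi, then f (x x^* ) y = 0 whenever
Phi (x x^* ) y = 0. For x = y on the torus |x_i| = 1 this is a trigonometric
identity; its Fourier coefficients, together with the zeros y = e_l for
x_l = x_(s l) = 0, leave only the entries M_kl := c k l k l and
e_k := c (s k) (s k) k k. Removing the index m, the pairs
x = (1, t, t^2), y = (1, 1/t, 1/t^2) are zeros of Phi in the limit t -> 0, so
M without row and column m is positive semidefinite and kills the all-ones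
vector. Together with the row relations sum_l M_kl = - e_k of the torus this
gives M_km = - e_k for k <> m, hence f = e Phi.

The case k = 3 is the reversal of k = 1. For k = 2, Phi is the sum of the
completely copositive maps A |-> V A^T V^* for V = E_02 - E_20 and
V = E_13 - E_31, and of the Schur multiplier by the Laplacian of the 4-cycle.
*)

Lemma sum_kron (V : nmodType) (n : nat) (k : 'I_n) (a : V) : \sum_l a *+ (k == l) = a.
Proof.
rewrite (bigD1 k) //= eqxx big1 ?addr0 // => l.
by rewrite eq_sym => /negbTE->.
Qed.

(** * Positive semidefinite complex matrices and their kernels *)

Section PsdMatrices.
Variable R : realType.
Local Notation C := R[i].

(** The order on [C] is partial, so [a] is first shown real, from [t = 1]. If [a] were negative,
    [t = - a / (b + 1)] would give the negative value [a / (b + 1)]. *)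
Lemma ge0_lim (a b : C) : 0 <= b -> (forall t : C, 0 < t -> 0 <= a + t * b) -> 0 <= a.
Proof.
move=> b0 H; have ar : a \is Num.real.
  have -> : a = (a + 1 * b) - b by ring.
  by rewrite rpredB // ger0_real // H.
rewrite real_leNgt ?real0 //; apply/negP => a0.
have b1 : 0 < b + 1 by rewrite ltr_wpDl.
have b1n : b + 1 != 0 by rewrite gt_eqF.
have := H (- a / (b + 1)); rewrite divr_gt0 ?oppr_gt0 // => /(_ isT).
have -> : a + - a / (b + 1) * b = a / (b + 1) by field.
by rewrite lt_geF // pmulr_llt0 ?invr_gt0.
Qed.

Lemma adjmxE m n (A : 'M[C]_(m, n)) i j : adjmx A i j = (A j i)^*.
Proof. by rewrite !mxE. Qed.

Lemma adjmx_delta m n i j : adjmx (delta_mx i j : 'M[C]_(m, n)) = delta_mx j i.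
Proof. by rewrite /adjmx map_delta_mx trmx_delta. Qed.

Lemma adjmxK m n (A : 'M[C]_(m, n)) : adjmx (adjmx A) = A.
Proof. by apply/matrixP=> i j; rewrite !adjmxE conjCK. Qed.

Lemma adjmxM m n p (A : 'M[C]_(m, n)) (B : 'M[C]_(n, p)) :
  adjmx (A *m B) = adjmx B *m adjmx A.
Proof. by rewrite /adjmx map_mxM trmx_mul. Qed.

Lemma adjmxD m n (A B : 'M[C]_(m, n)) : adjmx (A + B) = adjmx A + adjmx B.
Proof. by rewrite /adjmx map_mxD linearD. Qed.

Lemma adjmxZ m n a (A : 'M[C]_(m, n)) : adjmx (a *: A) = a^* *: adjmx A.
Proof. by rewrite /adjmx map_mxZ linearZ. Qed.

Lemma formE n (A : 'M[C]_n) (v : 'cV[C]_n) :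
  (adjmx v *m A *m v) 0 0 = \sum_k \sum_l (v k 0)^* * A k l * v l 0.
Proof.
rewrite mxE exchange_big /=; apply: eq_bigr => l _; rewrite mxE mulr_suml.
by apply: eq_bigr => k _; rewrite adjmxE.
Qed.

Lemma psd_conj n (A : 'M[C]_n) i j : psd A -> (A i j)^* = A j i.
Proof. by case=> h _; rewrite -{2}h adjmxE. Qed.

Lemma psdD n (A B : 'M[C]_n) : psd A -> psd B -> psd (A + B).
Proof.
move=> [hA pA] [hB pB]; split; first by rewrite adjmxD hA hB.
by move=> v; rewrite mulmxDr mulmxDl mxE addr_ge0.
Qed.

Lemma psd_sandwich n (V A : 'M[C]_n) : psd A -> psd (V *m A *m adjmx V).
Proof.
move=> [hA pA]; split; first by rewrite !adjmxM adjmxK hA mulmxA.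
by move=> v; have := pA (adjmx V *m v); rewrite adjmxM adjmxK !mulmxA.
Qed.

Lemma psd_tr n (A : 'M[C]_n) : psd A -> psd A^T.
Proof.
move=> psdA; have [_ pA] := psdA; split.
  by apply/matrixP=> i j; rewrite adjmxE !mxE (psd_conj _ _ psdA).
move=> v; have := pA (map_mx Num.conj v); rewrite !formE exchange_big /=.
congr (0 <= _); apply: eq_bigr => k _; apply: eq_bigr => l _.
by rewrite !mxE conjCK; ring.
Qed.

Definition outer n (x : 'cV[C]_n) : 'M[C]_n := x *m adjmx x.

Lemma outerE n (x : 'cV[C]_n) i j : outer x i j = x i 0 * (x j 0)^*.
Proof. by rewrite mxE big_ord1 adjmxE. Qed.

Lemma sqnorm_ge0 n (v : 'cV[C]_n) : 0 <= (adjmx v *m v) 0 0.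
Proof.
by rewrite mxE sumr_ge0 // => i _; rewrite adjmxE mulrC mul_conjC_ge0.
Qed.

Lemma psd_outer n (x : 'cV[C]_n) : psd (outer x).
Proof.
split; first by rewrite adjmxM adjmxK.
move=> v; rewrite /outer mulmxA -(mulmxA (_ *m x)).
have -> : adjmx v *m x = adjmx (adjmx x *m v) by rewrite adjmxM adjmxK.
exact: sqnorm_ge0.
Qed.

Lemma sqnorm_eq0 n (v : 'cV[C]_n) : (adjmx v *m v) 0 0 = 0 -> v = 0.
Proof.
rewrite mxE => /eqP; rewrite psumr_eq0; last first.
  by move=> i _; rewrite adjmxE mulrC mul_conjC_ge0.
move=> /allP h; apply/matrixP=> i j; rewrite ord1 mxE; apply/eqP.
by have := h i (mem_index_enum i); rewrite adjmxE mulrC mul_conjC_eq0.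
Qed.

(** With [w = A v], the form at [v - t w] is [- 2 t |w|^2 + t^2 w^* A w]. Dividing by [t > 0] and
    letting [t] tend to 0 forces [|w|^2 <= 0]. *)
Lemma psd_ker n (A : 'M[C]_n) (v : 'cV[C]_n) :
  psd A -> (adjmx v *m A *m v) 0 0 = 0 -> A *m v = 0.
Proof.
move=> [hA pA] v0; set w := A *m v; apply: sqnorm_eq0; apply/eqP.
have wE : adjmx v *m A = adjmx w by rewrite adjmxM hA.
rewrite eq_le sqnorm_ge0 andbT -(pmulr_rle0 _ (ltr0n _ 2)) -oppr_ge0.
apply: (@ge0_lim _ ((adjmx w *m A *m w) 0 0)) => // t t0.
have tc : t^* = t by rewrite (CrealP _) // gtr0_real.
have := pA (v - t *: w); rewrite -(pmulr_rge0 (_ + _) t0); congr (0 <= _).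
have ww : adjmx w *m A *m v = adjmx w *m w by rewrite -mulmxA.
rewrite -scaleNr adjmxD adjmxZ rmorphN /= tc mulmxDl mulmxDl !mulmxDr.
rewrite -?(@scalemxAr C) -?(@scalemxAl C) ww wE.
move: v0; rewrite wE.
move: (adjmx w *m v) (adjmx w *m w) (adjmx w *m A *m w) => a b c a0.
by rewrite !mxE a0; ring.
Qed.

End PsdMatrices.

(** * Coordinates of linear maps on matrix units *)

Section LinearMaps.
Variable R : realType.
Local Notation C := R[i].
Variables (n : nat) (f : 'M[C]_n -> 'M[C]_n).
Hypothesis linf : is_linear_map f.

Lemma lmapD A B : f (A + B) = f A + f B.
Proof. by have := linf 1 A B; rewrite !scale1r. Qed.

Lemma lmap0 : f 0 = 0.
Proof. by apply: (addrI (f 0)); rewrite -lmapD !addr0. Qed.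

Lemma lmapZ a A : f (a *: A) = a *: f A.
Proof. by have := linf a A 0; rewrite lmap0 !addr0. Qed.

Definition choi i j k l : C := f (delta_mx i j) k l.

Lemma lmapE A k l : f A k l = \sum_i \sum_j A i j * choi i j k l.
Proof.
rewrite [in LHS](matrix_sum_delta A) (big_morph f lmapD lmap0) summxE.
apply: eq_bigr => i _; rewrite (big_morph f lmapD lmap0) summxE.
by apply: eq_bigr => j _; rewrite lmapZ mxE.
Qed.

Lemma lmap_outer2 (u : C) i j k l :
  f (outer (delta_mx i 0 + u *: delta_mx j 0)) k l =
  choi i i k l + u^* * choi i j k l + (u * choi j i k l + u * u^* * choi j j k l).
Proof.
have addE (A B : 'M[C]_n) : (A + B) k l = A k l + B k l by rewrite mxE.
have scaleE a (A : 'M[C]_n) : (a *: A) k l = a * A k l by rewrite mxE.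
rewrite /outer adjmxD adjmxZ !adjmx_delta mulmxDl !mulmxDr.
rewrite -?(@scalemxAr C) -?(@scalemxAl C) -?(@scalemxAr C) !mul_delta_mx !lmapD !lmapZ.
by rewrite !addE !scaleE /choi; ring.
Qed.

End LinearMaps.

(** * Positive maps: polarization, kernels, conjugation *)

Section PositiveMaps.
Variable R : realType.
Local Notation C := R[i].

(** The hypotheses say that [u^* * a + u * b] vanishes at [u = 1] and [u = 'i]; the coefficient rows
    (1, 1) and (-i, i) are independent. *)
Lemma polar_eq0 (a b : C) :
  a + b = 0 -> 'i^* * a + 'i * b = 0 -> a = 0 /\ b = 0.
Proof.
rewrite conjCi => h1 h2; have -> : b = - a by apply/eqP; rewrite -addr_eq0 addrC h1.
suff -> : a = 0 by rewrite oppr0.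
have : 2 * a = 0.
  have -> : 2 * a = - ('i ^+ 2) * (a + a) by rewrite sqrCi; ring.
  have -> : - ('i ^+ 2) * (a + a) = 'i * (- 'i * a + 'i * b) - 'i ^+ 2 * (a + b) by ring.
  by rewrite h1 h2 !mulr0 subr0.
by move/eqP; rewrite mulf_eq0 pnatr_eq0 => /eqP.
Qed.

Variable n : nat.
Implicit Types (f : 'M[C]_n -> 'M[C]_n) (i j k l : 'I_n).

Lemma form_delta (A : 'M[C]_n) (k : 'I_n) :
  (adjmx (delta_mx k 0 : 'cV[C]_n) *m A *m (delta_mx k 0 : 'cV[C]_n)) 0 0 = A k k.
Proof. by rewrite -colE adjmx_delta -rowE !mxE. Qed.

Lemma delta_outer (i : 'I_n) : delta_mx i i = outer (delta_mx i 0) :> 'M[C]_n.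
Proof.
apply/matrixP => p q; rewrite outerE !mxE !eqxx !andbT rmorph_nat.
by rewrite -mulnb natrM.
Qed.

(** Images of rank-one psd matrices are Hermitian; polarization carries this over to the matrix
    units. *)
Lemma choiC f i j k l : positive_map f -> (choi f i j k l)^* = choi f j i l k.
Proof.
move=> [linf posf].
have diag p : (choi f p p k l)^* = choi f p p l k.
  by apply: psd_conj; apply: posf; rewrite delta_outer; apply: psd_outer.
have H (u : C) : u * ((choi f i j k l)^* - choi f j i l k) +
   u^* * ((choi f j i k l)^* - choi f i j l k) = 0.
  have := psd_conj k l (posf _ (psd_outer (delta_mx i 0 + u *: delta_mx j 0))).
  rewrite !lmap_outer2 // !rmorphD !rmorphM /= !conjCK !diag => h.
  apply/eqP; move/eqP: h; rewrite -subr_eq0; apply: etrans; congr (_ == _); ring.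
have h1 := H 1; rewrite rmorph1 !mul1r in h1.
have h2 := H 'i^*; rewrite conjCK in h2.
by have [/eqP] := polar_eq0 h1 h2; rewrite subr_eq0 => /eqP.
Qed.

Lemma positive_ker f g A (v : 'cV[C]_n) :
  positive_map f -> positive_map g -> psd A -> (f A + g A) *m v = 0 ->
  f A *m v = 0.
Proof.
move=> [_ pf] [_ pg] pA h; have [_ fA] := pf _ pA; have [_ gA] := pg _ pA.
apply: psd_ker (pf _ pA) _; apply/eqP; rewrite eq_le fA andbT.
have /eqP : (adjmx v *m ((f A + g A) *m v)) 0 0 = 0 by rewrite h mulmx0 mxE.
rewrite mulmxDl mulmxDr mxE !mulmxA addr_eq0 => /eqP ->.
by rewrite oppr_le0.
Qed.

(* The diagonal entry [f(x x^* )_kk] is a positive semidefinite form in [x]. *)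
Lemma choi_diag_eq0 f i j k :
  positive_map f -> choi f i i k k = 0 -> choi f i j k k = 0.
Proof.
move=> posf cii; have [linf pf] := posf.
pose G := \matrix_(p, q) choi f p q k k.
have psdG : psd G.
  split; first by apply/matrixP=> p q; rewrite adjmxE !mxE choiC.
  move=> v; rewrite formE.
  have [_ /(_ (delta_mx k 0))] := pf _ (psd_outer (map_mx Num.conj v)).
  congr (0 <= _); rewrite form_delta lmapE //.
  apply: eq_bigr => p _; apply: eq_bigr => q _.
  by rewrite outerE !mxE conjCK; ring.
have /matrixP/(_ j 0) : G *m delta_mx i 0 = 0 :> 'cV_n.
  by apply: psd_ker => //; rewrite form_delta mxE.
rewrite -colE !mxE => /(congr1 Num.conj); rewrite choiC // => ->.
by rewrite rmorph0.
Qed.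

Lemma positive_conj f (g : 'M[C]_n -> 'M[C]_n) :
  positive_map g -> positive_map f -> positive_map (fun A => g (f (g A))).
Proof.
move=> [lg pg] [lf pf]; split=> [a A B|A pA]; first by rewrite lg lf lg.
exact: pg (pf _ (pg _ pA)).
Qed.

(** As [g] is a linear involution, conjugating the summands of [h] by [g] decomposes [f], and the
    scalars carry back. *)
Lemma extremal_conj f (g h : 'M[C]_n -> 'M[C]_n) :
  positive_map g -> involutive g -> (forall A, h A = g (f (g A))) ->
  extremal_map f -> extremal_map h.
Proof.
move=> pg gK hE [pf extf]; have [lgf pgf] := positive_conj pg pf.
split; first by split=> [a A B|A pA]; rewrite !hE; [apply: lgf|apply: pgf].
move=> f1 f2 p1 p2 fE.
have [|l1 [l2 [l10 l20 h1 h2]]] := extf _ _ (positive_conj pg p1) (positive_conj pg p2).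
  by move=> A; rewrite -(lmapD (proj1 pg)) -fE hE !gK.
exists l1, l2; split=> // A.
  by rewrite hE -(lmapZ (proj1 pg)) -h1 !gK.
by rewrite hE -(lmapZ (proj1 pg)) -h2 !gK.
Qed.

End PositiveMaps.

Local Notation o0 := (@Ordinal 4 0 isT).
Local Notation o1 := (@Ordinal 4 1 isT).
Local Notation o2 := (@Ordinal 4 2 isT).
Local Notation o3 := (@Ordinal 4 3 isT).

Lemma ord4_ind (P : 'I_4 -> Prop) : P o0 -> P o1 -> P o2 -> P o3 -> forall i, P i.
Proof.
by move=> p0 p1 p2 p3 [[|[|[|[|m]]]] // h]; rewrite (bool_irrelevance h isT).
Qed.

Lemma big_ord4 (V : Type) (idx : V) (op : Monoid.law idx) (F : 'I_4 -> V) :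
  \big[op/idx]_(i < 4) F i = op (F o0) (op (F o1) (op (F o2) (F o3))).
Proof.
rewrite !big_ord_recl big_ord0 Monoid.mulm1.
by congr (op (F _) (op (F _) (op (F _) (F _)))); apply: val_inj.
Qed.

Definition sum4 (V : nmodType) := @big_ord4 V 0 +%R.

(** * Fourier coefficients of cubic identities on the torus *)

Section Torus.
Variable R : realType.
Local Notation C := R[i].

(** Orthogonality of the characters of Z/4. *)
Lemma sum_expi (n : nat) :
  \sum_(t < 4) ('i : C) ^+ (t * n)%N = if (4 %| n)%N then 4 else 0.
Proof.
have i4 : ('i : C) ^+ 4 = 1 by rewrite (exprM _ 2 2) sqrCi sqrrN expr1n.
have -> : \sum_(t < 4) ('i : C) ^+ (t * n)%N = \sum_(t < 4) ('i : C) ^+ (t * (n %% 4))%N.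
  apply: eq_bigr => t _.
  by rewrite {1}(divn_eq n 4) mulnDr exprD mulnA mulnC exprM i4 expr1n mul1r.
rewrite sum4 /= /dvdn !mul0n !mul1n expr0.
have: (n %% 4 < 4)%N by rewrite ltn_mod.
have i2 := sqrCi C; have i3 : ('i : C) ^+ 3 = - 'i by rewrite exprS i2 mulrN1.
case: (n %% 4)%N => [|[|[|[|//]]]] _ /=.
- by rewrite !muln0 expr0; ring.
- by rewrite !muln1 i2 i3 expr1; ring.
- by rewrite !(mulnC _ 2) !exprM i2; ring.
- by rewrite !(mulnC _ 3) !exprM i3 [_ ^+ 3]exprS sqrrN i2; ring.
Qed.

(* On fourth roots of unity [x^* = x ^+ 3], so [expo i j l p q r a] is the
   exponent of [x a] in [x i * (x j)^* * x l * (x p * (x q)^* * x r)^*]. The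
   exponents of the two factors range over {-1, 0, 1, 2}, hence are determined
   modulo 4. *)
Definition expo (i j l p q r a : 'I_4) : nat :=
  ((i == a) + 3 * (j == a) + (l == a) + 3 * (p == a) + (q == a) + 3 * (r == a))%N.

Definition resonant i j l p q r : bool :=
  [&& (4 %| expo i j l p q r o0)%N, (4 %| expo i j l p q r o1)%N,
      (4 %| expo i j l p q r o2)%N & (4 %| expo i j l p q r o3)%N].

(** Fourth roots of unity suffice: the identity is summed over the [4 ^ 4 = 256] points [x g]
    against the conjugate of the monomial of [p, q, r]. The sum factors over the four coordinates,
    and [sum_expi] keeps exactly the resonant terms. *)
Lemma torus_coef (c : 'I_4 -> 'I_4 -> 'I_4 -> C) :
  (forall x : 'I_4 -> C, (forall i, x i * (x i)^* = 1) ->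
     \sum_i \sum_j \sum_l c i j l * (x i * (x j)^* * x l) = 0) ->
  forall p q r,
  \sum_i \sum_j \sum_l (if resonant i j l p q r then c i j l else 0) = 0.
Proof.
move=> H p q r.
pose x (g : {ffun 'I_4 -> 'I_4}) (a : 'I_4) : C := 'i ^+ g a.
have x1 g a : x g a * (x g a)^* = 1.
  by rewrite /x rmorphXn /= conjCi -exprMn mulrN -expr2 sqrCi opprK expr1n.
have xc g a : (x g a)^* = x g a ^+ 3.
  have x4 : x g a ^+ 4 = 1.
    by rewrite /x -exprM mulnC exprM (exprM _ 2 2) sqrCi sqrrN expr1n expr1n.
  by rewrite -[LHS]mul1r -x4 exprSr -mulrA x1 mulr1.
have pick g i n : x g i ^+ n = \prod_a x g a ^+ (n * (i == a))%N.
  rewrite (bigD1 i) //= eqxx muln1 big1 ?mulr1 // => a /negbTE.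
  by rewrite eq_sym => ->; rewrite muln0.
have mon g i j l : x g i * (x g j)^* * x g l * (x g p ^+ 3 * x g q * x g r ^+ 3) =
    \prod_a 'i ^+ (g a * expo i j l p q r a)%N.
  rewrite xc -[x g i]expr1 -[x g l]expr1 -[x g q]expr1 !pick -!big_split /=.
  apply: eq_bigr => a _; rewrite /expo [RHS]exprM -/(x g a) !mul1n.
  by rewrite !exprD !mulrA.
have: \sum_(g : {ffun 'I_4 -> 'I_4})
    (\sum_i \sum_j \sum_l c i j l * (x g i * (x g j)^* * x g l)) *
    (x g p ^+ 3 * x g q * x g r ^+ 3) = 0.
  by rewrite big1 // => g _; rewrite H ?mul0r.
have c256 : 256 != 0 :> C by rewrite pnatr_eq0.
move=> E; apply/(mulfI c256); rewrite mulr0 -[RHS]E.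
transitivity (\sum_(g : {ffun 'I_4 -> 'I_4}) \sum_i \sum_j \sum_l
    c i j l * \prod_a ('i : C) ^+ (g a * expo i j l p q r a)%N); last first.
  apply: eq_bigr => g _; rewrite mulr_suml; apply: eq_bigr => i _.
  rewrite mulr_suml; apply: eq_bigr => j _; rewrite mulr_suml.
  by apply: eq_bigr => l _; rewrite -mulrA mon.
rewrite [RHS]exchange_big mulr_sumr /=; apply: eq_bigr => i _.
rewrite [RHS]exchange_big mulr_sumr /=; apply: eq_bigr => j _.
rewrite [RHS]exchange_big mulr_sumr /=; apply: eq_bigr => l _.
rewrite -mulr_sumr.
rewrite -(bigA_distr_bigA
  (fun a (t : 'I_4) => ('i : C) ^+ (t * expo i j l p q r a)%N)) /=.
under eq_bigr => a _ do rewrite sum_expi.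
rewrite (big_ord4 _ (fun a => if (4 %| expo i j l p q r a)%N then 4 else 0 : C)) /=.
rewrite /resonant.
by do 4 case: (4 %| _)%N => /=; ring.
Qed.

End Torus.

Ltac compute_resonant :=
  repeat match goal with
  | |- context [resonant ?a ?b ?c ?d ?e ?f] =>
    let v := eval vm_compute in (resonant a b c d e f) in
    change (resonant a b c d e f) with v
  end.

Section TorusZeros.
Variable R : realType.
Local Notation C := R[i].
Variable c : 'I_4 -> 'I_4 -> 'I_4 -> C.
Hypothesis torus0 : forall x : 'I_4 -> C, (forall i, x i * (x i)^* = 1) ->
  \sum_i \sum_j \sum_l c i j l * (x i * (x j)^* * x l) = 0.

(** Only the triple [(i, j, i)] produces the monomial [x_i^2 x_j^*]. *)
Lemma torus_coef2 i j : i != j -> c i j i = 0.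
Proof.
move=> ij; have := torus_coef torus0 i j i; rewrite !sum4.
elim/ord4_ind: i ij; elim/ord4_ind: j => // _;
  by compute_resonant; rewrite /= ?addr0 ?add0r.
Qed.

Lemma torus_coef11 i j l : i != j -> l != j -> i != l -> c i j l + c l j i = 0.
Proof.
move=> ij lj il; have := torus_coef torus0 i j l; rewrite !sum4.
elim/ord4_ind: i ij il; elim/ord4_ind: j lj; elim/ord4_ind: l => // _ _ _;
  by compute_resonant; rewrite /= ?addr0 ?add0r // addrC.
Qed.

(** The monomial [x_m] arises from [(m, j, j)] and from [(j, j, m)]; the test [j == m] prevents
    counting [(m, m, m)] twice. *)
Lemma torus_coef1 m : \sum_j c m j j + \sum_j (if j == m then 0 else c j j m) = 0.
Proof.
have := torus_coef torus0 m m m; rewrite !sum4.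
by elim/ord4_ind: m; compute_resonant => /= h; rewrite -[RHS]h; ring.
Qed.

End TorusZeros.

(** * The maps [Phi4] and the zeros of [Phi4 1] *)

Section Phi.
Variable R : realType.
Local Notation C := R[i].

Lemma sigma1E : (sigma 1 o0 = o1) * (sigma 1 o1 = o2) *
  (sigma 1 o2 = o3) * (sigma 1 o3 = o0).
Proof. by do !split; apply: val_inj; rewrite /= inordK. Qed.

Lemma sigma2E : (sigma 2 o0 = o2) * (sigma 2 o1 = o3) *
  (sigma 2 o2 = o0) * (sigma 2 o3 = o1).
Proof. by do !split; apply: val_inj; rewrite /= inordK. Qed.

Lemma sigma1_neq k : (sigma 1 k != k) * (sigma 1 (sigma 1 k) != k).
Proof. by elim/ord4_ind: k; rewrite !sigma1E. Qed.

Lemma Phi4E k (A : 'M[C]_4) i j : Phi4 k A i j =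
  (3 * A i i + A (sigma k i) (sigma k i)) *+ (i == j) - A i j.
Proof. by rewrite !mxE. Qed.

Lemma Phi4_linear k : is_linear_map (@Phi4 R k).
Proof.
move=> a A B; apply/matrixP=> i j; rewrite [RHS]mxE [X in _ = X + _]mxE !Phi4E !mxE.
by case: (i == j); rewrite ?mulr1n ?mulr0n; ring.
Qed.

(** On the torus [Phi4 1 (outer x)] is [4 I - outer x], and [outer x] multiplies [x] by 4. *)
Lemma Phi4_torus (x : 'cV[C]_4) : (forall i, x i 0 * (x i 0)^* = 1) ->
  Phi4 1 (outer x) *m x = 0.
Proof.
move=> x1; apply/matrixP => i j; rewrite ord1 !mxE.
have -> : \sum_k Phi4 1 (outer x) i k * x k 0 =
    \sum_k (4 * x i 0 *+ (i == k) - x i 0).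
  apply: eq_bigr => k _; rewrite Phi4E !outerE !x1 mulrBl -mulrA [_^* * _]mulrC x1.
  by case: eqP => [->|_]; rewrite ?mulr1n ?mulr0n; ring.
by rewrite sum4; elim/ord4_ind: i => /=; rewrite ?mulr1n ?mulr0n; ring.
Qed.

Lemma Phi4_supp (x : 'cV[C]_4) l : x l 0 = 0 -> x (sigma 1 l) 0 = 0 ->
  Phi4 1 (outer x) *m delta_mx l 0 = 0 :> 'cV_4.
Proof.
move=> xl xs; apply/matrixP => i j; rewrite ord1 -colE [LHS]mxE [RHS]mxE Phi4E !outerE.
by case: eqP => [->|_]; rewrite ?mulr1n ?mulr0n ?xl ?xs ?rmorph0; ring.
Qed.

End Phi.

(** * Coefficients of a positive summand of [Phi4 1] *)

Section Summand.
Variable R : realType.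
Local Notation C := R[i].
Variables f g : 'M[C]_4 -> 'M[C]_4.
Hypotheses (posf : positive_map f) (posg : positive_map g).
Hypothesis fgE : forall A, Phi4 1 A = f A + g A.

Let linf := proj1 posf.
Local Notation c := (choi f).
Local Notation s := (sigma 1).

Lemma summand_ker A (v : 'cV[C]_4) : psd A -> Phi4 1 A *m v = 0 -> f A *m v = 0.
Proof. by rewrite fgE; apply: positive_ker. Qed.

Lemma summand_torus k (x : 'I_4 -> C) : (forall i, x i * (x i)^* = 1) ->
  \sum_i \sum_j \sum_l c i j k l * (x i * (x j)^* * x l) = 0.
Proof.
move=> x1; pose v : 'cV[C]_4 := \col_i x i.
have : f (outer v) *m v = 0.
  apply: summand_ker; first exact: psd_outer.
  by apply: Phi4_torus => i; rewrite mxE.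
move=> /matrixP/(_ k 0); rewrite !mxE => h; rewrite -[RHS]h.
transitivity (\sum_l \sum_i \sum_j c i j k l * (x i * (x j)^* * x l)).
  by rewrite [RHS]exchange_big /=; apply: eq_bigr => i _; rewrite exchange_big.
apply: eq_bigr => l _; rewrite lmapE // mulr_suml; apply: eq_bigr => i _.
rewrite mulr_suml; apply: eq_bigr => j _; rewrite outerE !mxE; ring.
Qed.

(** Column [l] of [f (outer x)] vanishes whenever [x] is supported off [l] and [s l]; polarizing in
    such [x] isolates [E_ij]. *)
Lemma choi_supp i j k l : i != l -> i != s l -> j != l -> j != s l -> c i j k l = 0.
Proof.
move=> il isl jl jsl.
have Z (x : 'cV[C]_4) : x l 0 = 0 -> x (s l) 0 = 0 -> f (outer x) k l = 0.
  move=> xl xs; have := summand_ker (psd_outer x) (Phi4_supp xl xs).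
  by rewrite -colE => /matrixP/(_ k 0); rewrite !mxE.
have D p : p != l -> p != s l -> c p p k l = 0.
  move=> pl ps; rewrite /choi delta_outer Z // mxE eq_sym ?(negbTE pl) //.
  by rewrite (negbTE ps).
have H u : u^* * c i j k l + u * c j i k l = 0.
  have := Z (delta_mx i 0 + u *: delta_mx j 0).
  rewrite lmap_outer2 // !D // mulr0 add0r addr0; apply; rewrite !mxE !eqxx.
    by rewrite ![l == _]eq_sym (negbTE il) (negbTE jl) /= mulr0 addr0.
  by rewrite ![s l == _]eq_sym (negbTE isl) (negbTE jsl) /= mulr0 addr0.
have h1 := H 1; rewrite rmorph1 !mul1r in h1.
by have [] := polar_eq0 h1 (H 'i).
Qed.

Lemma choi_supp' i j k l : i != k -> i != s k -> j != k -> j != s k -> c i j k l = 0.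
Proof.
by move=> *; rewrite -[LHS]conjCK choiC // choi_supp ?rmorph0.
Qed.

Lemma choi_row i j k : i != j -> c i j k i = 0.
Proof. exact: torus_coef2 (summand_torus k) _ _. Qed.

Lemma choi_col i j l : i != j -> c i j j l = 0.
Proof.
by move=> ij; rewrite -[LHS]conjCK choiC // choi_row ?rmorph0 // eq_sym.
Qed.

Lemma choi_swap i j k l : i != j -> l != j -> i != l -> c i j k l = - c l j k i.
Proof.
move=> ij lj il; apply/eqP; rewrite -addr_eq0; apply/eqP.
exact: (torus_coef11 (summand_torus k)).
Qed.

Lemma choi_swap' i j k l : i != j -> k != i -> j != k -> c i j k l = - c i k j l.
Proof.
move=> ij ki jk; rewrite -[LHS]conjCK choiC // (@choi_swap j i l k) //; last first.
  by rewrite eq_sym.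
by rewrite rmorphN /= choiC.
Qed.

(** Once [i] and [j] differ from [k], one of them also differs from [s k]. Its diagonal coefficient
    vanishes by [choi_supp], and [choi_diag_eq0] propagates this to the mixed one. *)
Lemma choi_diag i j k : i != j -> c i j k k = 0.
Proof.
move=> ij; have [->|ki] := eqVneq k i; first exact: choi_row.
have [->|kj] := eqVneq k j; first exact: choi_col.
have [si|si] := eqVneq i (s k); last first.
  by apply: choi_diag_eq0 => //; apply: choi_supp => //; rewrite eq_sym.
rewrite -[LHS]conjCK choiC // choi_diag_eq0 ?rmorph0 //.
by apply: choi_supp => //; rewrite 1?eq_sym // -si.
Qed.

(** In the 4-cycle [k] has two neighbours among [i], [j], [l], hence is adjacent to [l] or to [i].
    Next to [l] a support argument applies at once; next to [i] it applies after [choi_swap]. *)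
Lemma choi_distinct i j k l : uniq [:: i; j; k; l] -> c i j k l = 0.
Proof.
elim/ord4_ind: i; elim/ord4_ind: j => //; elim/ord4_ind: k => //.
all: elim/ord4_ind: l => // _.
all: first
 [ by apply: choi_supp; rewrite ?sigma1E
 | by apply: choi_supp'; rewrite ?sigma1E
 | by rewrite choi_swap // choi_supp ?sigma1E ?oppr0
 | by rewrite choi_swap // choi_supp' ?sigma1E ?oppr0
 | by rewrite choi_swap' // choi_supp ?sigma1E ?oppr0
 | by rewrite choi_swap' // choi_supp' ?sigma1E ?oppr0 ].
Qed.

Lemma choi_offl i j l : i != j -> l != i -> l != j -> c i j i l = 0.
Proof.
move=> ij li lj; rewrite choi_swap // 1?eq_sym //.
by rewrite choi_diag ?oppr0.
Qed.

Lemma choi_offr i j k : i != j -> k != i -> k != j -> c i j k j = 0.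
Proof.
move=> ij ki kj; rewrite -[LHS]conjCK choiC // choi_offl ?rmorph0 //.
by rewrite eq_sym.
Qed.

Lemma choi_sum m k : \sum_j c m j k j + \sum_j (if j == m then 0 else c j j k m) = 0.
Proof. exact: (torus_coef1 (summand_torus k)). Qed.

(** In row [k] of the torus identity, this is the only term left in the coefficient of [x_(s k)]. *)
Lemma choi_next k : c (s k) (s k) k (s k) = 0.
Proof.
have [sk ssk] := sigma1_neq k.
have := choi_sum (s k) k; rewrite (bigD1 (s k)) //= !big1 ?addr0 //.
- move=> j _; case: eqVneq => // jsk; have [->|jssk] := eqVneq j (s (s k)).
    by apply: choi_supp'; rewrite ?ssk ?sigma1_neq.
  exact: choi_supp.
- move=> j jsk; have [->|jk] := eqVneq j k.
    exact: choi_diag.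
  by apply: choi_offr; rewrite eq_sym // eq_sym.
Qed.

(** Both support arguments fail only if [k] and [l] are consecutive and [i] is the later one; that
    is [choi_next] or its conjugate. *)
Lemma choi_block i k l : k != l -> c i i k l = 0.
Proof.
have next' p : c (s p) (s p) (s p) p = 0.
  by rewrite -[LHS]conjCK choiC // choi_next rmorph0.
move: (choi_next o0) (choi_next o1) (choi_next o2) (choi_next o3).
move: (next' o0) (next' o1) (next' o2) (next' o3); rewrite !sigma1E.
elim/ord4_ind: i; elim/ord4_ind: k; elim/ord4_ind: l => // *.
all: first [ by apply: choi_supp; rewrite ?sigma1E
           | by apply: choi_supp'; rewrite ?sigma1E ].
Qed.

Lemma choi_eq0 i j k l : (i != k) || (j != l) ->
  ~~ [&& i == j, k == l & i == s k] -> c i j k l = 0.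
Proof.
have [<-{j}|ij] := eqVneq i j; have [<-{l}|kl] := eqVneq k l => /=.
- rewrite orbb => ik isk; exact: choi_supp.
- by move=> _ _; apply: choi_block.
- by move=> _ _; apply: choi_diag.
move=> ikjl _.
have [<-|li] := eqVneq i l; first exact: choi_row.
have [<-|jk] := eqVneq j k; first exact: choi_col.
have [ik|ik] := eqVneq i k.
  subst k; move: ikjl; rewrite eqxx /= eq_sym => lj.
  by apply: choi_offl; rewrite // eq_sym.
have [jl|jl] := eqVneq j l.
  by subst l; apply: choi_offr; rewrite // eq_sym.
apply: choi_distinct => /=.
by rewrite !inE !negb_or ij ik li jk jl kl.
Qed.

Lemma summandE A k l : f A k l =
  c k l k l * A k l + (c (s k) (s k) k k * A (s k) (s k)) *+ (k == l).
Proof.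
rewrite lmapE // (bigD1 k) //= (bigD1 l) //= mulrC -addrA; congr (_ + _).
have [kl|kl] := eqVneq k l.
  subst l; rewrite big1 ?add0r; last first.
    move=> j jk; rewrite choi_eq0 ?mulr0 ?jk ?orbT //.
    by rewrite eq_sym (negbTE jk).
  have [sk _] := sigma1_neq k.
  rewrite (bigD1 (s k)) //= (bigD1 (s k)) //= !big1 ?addr0 1?mulrC //.
  - move=> i /andP[ik isk]; rewrite big1 // => j _; rewrite choi_eq0 ?ik ?mulr0 //.
    by rewrite (negbTE isk) !andbF.
  - move=> j jsk; rewrite choi_eq0 ?sk ?mulr0 //.
    by rewrite eq_sym (negbTE jsk).
rewrite !big1 ?addr0 // => [i ik|j jl].
  by rewrite big1 // => j _; rewrite choi_eq0 ?ik ?mulr0 // (negbTE kl) /= andbF.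
by rewrite choi_eq0 ?jl ?orbT ?mulr0 // (negbTE kl) andbF.
Qed.

Lemma choi_next_ge0 k : 0 <= c (s k) (s k) k k.
Proof.
have : psd (f (delta_mx (s k) (s k))).
  by apply: (proj2 posf); rewrite delta_outer; apply: psd_outer.
by case=> _ /(_ (delta_mx k 0)); rewrite form_delta.
Qed.

(** Row and column [m] are zeroed rather than deleted, which keeps the index type ['I_4]. *)
Definition minor m : 'M[C]_4 :=
  \matrix_(k, l) if (k == m) || (l == m) then 0 else c k l k l.

(* With [x = w] and [y = v / w] off [m], the term [|x_(s k) y_k|^2] equals
   [(w_(s k) / w_k)^2 |v_k|^2]; it vanishes in the limit when [w] is geometric
   along the path [s m, s (s m), s (s (s m))]. *)
Lemma psd_minor m : psd (minor m).
Proof.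
split.
  by apply/matrixP=> k l; rewrite adjmxE !mxE orbC; case: ifP; rewrite ?rmorph0 ?choiC.
move=> v; rewrite formE.
(* The test vectors vanish at [m], so the shift term is absent also when [s k = m]. *)
pose b k := if (k == m) || (s k == m) then 0
  else c (s k) (s k) k k * ((v k 0)^* * v k 0).
apply: (@ge0_lim _ _ (\sum_k b k)) => [|t t0].
  apply: sumr_ge0 => k _; rewrite /b; case: ifP => // _.
  by rewrite mulr_ge0 ?choi_next_ge0 // mulrC mul_conjC_ge0.
(* Successive weights have ratio [r], so the squared ratio in front of the shift term is [t]. *)
pose r := sqrtC t; have r0 : 0 < r by rewrite sqrtC_gt0.
pose w k := if k == s m then 1 else if k == s (s m) then r else r ^+ 2.
have w0 k : w k != 0.
  by rewrite /w; do ?case: ifP => _; rewrite ?oner_eq0 ?expf_neq0 // gt_eqF.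
have wc k : (w k)^* = w k.
  have rc : r^* = r by rewrite (CrealP _) // gtr0_real.
  by rewrite /w; do ?case: ifP => _; rewrite ?rmorph1 ?rmorphXn /= ?rc.
have ws k : k != m -> s k != m -> w (s k) = r * w k.
  rewrite /w; clear b w w0 wc; elim/ord4_ind: m; elim/ord4_ind: k => //;
    by rewrite !sigma1E //= ?mulr1 ?expr2.
pose x : 'cV[C]_4 := \col_k if k == m then 0 else w k.
pose y : 'cV[C]_4 := \col_k if k == m then 0 else v k 0 / w k.
have [_ /(_ y)] := proj2 posf _ (psd_outer x); congr (0 <= _).
rewrite formE mulr_sumr -big_split /=; apply: eq_bigr => k _.
rewrite -[t * b k](sum_kron k) -big_split /=; apply: eq_bigr => l _.
rewrite summandE !outerE !mxE; have [->|km] := eqVneq k m.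
  by rewrite /b eqxx rmorph0 !mul0r !mulr0 mul0rn mul0r addr0.
have [->|lm] := eqVneq l m; first by rewrite (negbTE km) !mulr0 mul0r addr0.
have wk := w0 k; have wl := w0 l.
rewrite fmorph_div /= !wc; have [kl|kl] := eqVneq k l; last first.
  by rewrite !mulr0n !addr0; field; apply/andP.
subst l; rewrite !mulr1n /b (negbTE km) /=; have [skm|skm] := eqVneq (s k) m.
  by rewrite !mul0r !mulr0 !addr0; field.
by rewrite wc ws // -[t]sqrtCK -/r; field.
Qed.

Lemma choi_row_sum k : \sum_j c k j k j + c (s k) (s k) k k = 0.
Proof.
rewrite -[RHS](choi_sum k k) [X in _ = _ + X](bigD1 (s k)) //=.
rewrite [X in _ = _ + (_ + X)]big1 ?addr0 ?(negbTE (fst (sigma1_neq k))) //.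
move=> j jsk; case: eqVneq => // jk; exact: choi_supp.
Qed.

End Summand.

(** * Proportionality of positive summands of [Phi4 1] *)

Section Extremality.
Variable R : realType.
Local Notation C := R[i].
Local Notation s := (sigma 1).

Lemma choi_Phi4 k l : choi (@Phi4 R 1) k l k l = 3 * (k == l)%:R - 1.
Proof.
rewrite /choi Phi4E !mxE !eqxx /=; have [->|kl] := eqVneq k l.
  by rewrite (negbTE (fst (sigma1_neq l))) /= !mulr1n; ring.
by rewrite /= !mulr0n; ring.
Qed.

(** The minors of [f] and [g] add up to [3 I - J] on the three indices other than [m], with [J] the
    all-ones matrix. Its form at the all-ones vector is 0, so both nonnegative forms vanish
    there. *)
Lemma minor_ker (f g : 'M[C]_4 -> 'M[C]_4) (m : 'I_4) :
  positive_map f -> positive_map g -> (forall A, Phi4 1 A = f A + g A) ->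
  minor f m *m (\col_k (k != m)%:R) = 0.
Proof.
move=> pf pg fgE; have gfE A : Phi4 1 A = g A + f A by rewrite fgE addrC.
have psf := psd_minor pf pg fgE m; have psg := psd_minor pg pf gfE m.
have [_ f0] := psf; have [_ g0] := psg.
set u := \col_k _; apply: psd_ker => //; apply/eqP; rewrite eq_le f0 andbT.
rewrite -oppr_ge0; congr (0 <= _) : (g0 u); apply/eqP; rewrite -addr_eq0; apply/eqP.
have choiD k l : choi g k l k l = 3 * (k == l)%:R - 1 - choi f k l k l.
  by rewrite -choi_Phi4 /choi fgE mxE [X in X - _]addrC addrK.
rewrite !formE -big_split big1 //=; move=> k _.
rewrite !sum4 !mxE !choiD.
clear; elim/ord4_ind: m; elim/ord4_ind: k; rewrite /= ?(rmorph0, rmorph1); ring.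
Qed.

Lemma summand_proportional (f g : 'M[C]_4 -> 'M[C]_4) :
  positive_map f -> positive_map g -> (forall A, Phi4 1 A = f A + g A) ->
  exists2 a : C, 0 <= a & forall A, f A = a *: Phi4 1 A.
Proof.
move=> pf pg fgE; pose e k := choi f (s k) (s k) k k.
have ge0 k : 0 <= e k by exact: choi_next_ge0 pf k.
(* Subtracting the row relation of [minor f m] from [choi_row_sum] leaves only the entry in column
   [m]. *)
have off k m : k != m -> choi f k m k m = - e k.
  move=> km; apply/eqP; rewrite -addr_eq0 -[X in _ == X](choi_row_sum pf pg fgE k).
  rewrite -subr_eq0 opprD addrACA subrr addr0 (bigD1 m) //= opprD addrA subrr add0r.
  rewrite oppr_eq0; have /matrixP/(_ k 0) := minor_ker m pf pg fgE.
  rewrite !mxE (bigD1 m) //= !mxE eqxx mulr0 add0r => h; rewrite -[X in _ == X]h.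
  apply/eqP; apply: eq_bigr => l lm.
  by rewrite !mxE (negbTE km) (negbTE lm) mulr1.
(* Hermitian symmetry of the coefficients compares [- e k] with [- e o0], both real. *)
have e0 k : e k = e o0.
  have [->//|k0] := eqVneq k o0.
  have := choiC k o0 k o0 pf; rewrite !off // 1?eq_sym // rmorphN /=.
  by rewrite (CrealP _) ?ger0_real // => /oppr_inj.
(* The row relation now reads [M_kk - 3 e + e = 0]. *)
have diag k : choi f k k k k = 2 * e o0.
  have := choi_row_sum pf pg fgE k; rewrite -/(e k) e0 (bigD1 k) //=.
  rewrite (eq_bigr (fun=> - e o0)) => [|l lk]; last by rewrite off 1?eq_sym // e0.
  rewrite sumr_const (_ : #|_| = 3%N); last first.
    by rewrite cardC1 card_ord.
  by move=> h; apply/eqP; rewrite -subr_eq0 -h; apply/eqP; ring.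
exists (e o0) => // A; apply/matrixP => k l.
rewrite (summandE pf pg fgE) -/(e k) e0 mxE Phi4E.
have [<-|kl] := eqVneq k l; first by rewrite diag !mulr1n; ring.
by rewrite off // e0 !mulr0n; ring.
Qed.

End Extremality.

(** * The cyclic inequality over the reals *)

Section RealInequality.
Variable R : realFieldType.

(** Over the common denominator, 1 minus the left side has numerator [N], a combination of squares
    whose coefficients are positive constants and a multiple of [x * y * z * w]. *)
Lemma cyclic_fractions_le1 (x y z w : R) : 0 < x -> 0 < y -> 0 < z -> 0 < w ->
  x ^+ 2 / (3 * x ^+ 2 + y ^+ 2) + y ^+ 2 / (3 * y ^+ 2 + z ^+ 2) +
  z ^+ 2 / (3 * z ^+ 2 + w ^+ 2) + w ^+ 2 / (3 * w ^+ 2 + x ^+ 2) <= 1.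
Proof.
move=> x0 y0 z0 w0.
have pos (u v : R) : 0 < u -> 0 < v -> 0 < 3 * u ^+ 2 + v ^+ 2.
  by move=> u0 v0; rewrite addr_gt0 ?mulr_gt0 ?exprn_gt0.
have p1 := pos _ _ x0 y0; have p2 := pos _ _ y0 z0.
have p3 := pos _ _ z0 w0; have p4 := pos _ _ w0 x0.
pose N := 3 * ((y * w * (x ^+ 2 - z ^+ 2)) ^+ 2 + (x * z * (y ^+ 2 - w ^+ 2)) ^+ 2 +
    ((x * z) ^+ 2 - (y * w) ^+ 2) ^+ 2) +
  2 * ((x * z * (x * w - y * z)) ^+ 2 + (y * w * (x * y - z * w)) ^+ 2 +
    2 * (x * y * z * w) * (x * z - y * w) ^+ 2).
have N0 : 0 <= N.
  have xyzw : 0 <= 2 * (x * y * z * w) by rewrite !mulr_ge0 // ltW.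
  by rewrite /N addr_ge0 // mulr_ge0 // !addr_ge0 ?sqr_ge0 // mulr_ge0 // sqr_ge0.
rewrite -subr_ge0.
suff -> : 1 - (x ^+ 2 / (3 * x ^+ 2 + y ^+ 2) + y ^+ 2 / (3 * y ^+ 2 + z ^+ 2) +
    z ^+ 2 / (3 * z ^+ 2 + w ^+ 2) + w ^+ 2 / (3 * w ^+ 2 + x ^+ 2)) =
    N / ((3 * x ^+ 2 + y ^+ 2) * (3 * y ^+ 2 + z ^+ 2) *
         (3 * z ^+ 2 + w ^+ 2) * (3 * w ^+ 2 + x ^+ 2)).
  by rewrite divr_ge0 // !mulr_ge0 // ltW.
by rewrite /N; field; rewrite !gt_eqF.
Qed.

Lemma cyclic_quartic (a b c d x y z w : R) : 0 <= x -> 0 <= y -> 0 <= z -> 0 <= w ->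
  (a * x + b * y + c * z + d * w) ^+ 2 <=
  a ^+ 2 * (3 * x ^+ 2 + y ^+ 2) + b ^+ 2 * (3 * y ^+ 2 + z ^+ 2) +
  c ^+ 2 * (3 * z ^+ 2 + w ^+ 2) + d ^+ 2 * (3 * w ^+ 2 + x ^+ 2).
Proof.
have three (p q r : R) : (p + q + r) ^+ 2 <= 3 * (p ^+ 2 + q ^+ 2 + r ^+ 2).
  have := sqr_ge0 (p - q); have := sqr_ge0 (p - r); have := sqr_ge0 (q - r); nra.
have sq (p q : R) := mulr_ge0 (sqr_ge0 p) (sqr_ge0 q).
have ax := sq a y; have bz := sq b z; have cw := sq c w; have dx := sq d x.
(* If a variable is 0, three terms remain on the left and [three] suffices; otherwise all
   denominators are positive. *)
rewrite le0r => /orP[/eqP-> *|x0].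
  by have := three (b * y) (c * z) (d * w); rewrite !exprMn in ax *; lra.
rewrite le0r => /orP[/eqP-> *|y0].
  by have := three (a * x) (c * z) (d * w); lra.
rewrite le0r => /orP[/eqP-> *|z0].
  by have := three (a * x) (b * y) (d * w); lra.
rewrite le0r => /orP[/eqP->|w0].
  by have := three (a * x) (b * y) (c * z); lra.
have pos (u v : R) : 0 < u -> 0 < v -> 0 < 3 * u ^+ 2 + v ^+ 2.
  by move=> u0 v0; rewrite addr_gt0 ?mulr_gt0 ?exprn_gt0.
have p1 := pos _ _ x0 y0; have p2 := pos _ _ y0 z0.
have p3 := pos _ _ z0 w0; have p4 := pos _ _ w0 x0.
have := cyclic_fractions_le1 x0 y0 z0 w0; set q := (X in X <= 1) => q1.
set S := _ + d * w.
(* [sum_i p_i (a_i - S x_i / p_i)^2 >= 0] is Cauchy-Schwarz. *)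
have : 0 <= (3 * x ^+ 2 + y ^+ 2) * (a - S * x / (3 * x ^+ 2 + y ^+ 2)) ^+ 2 +
    (3 * y ^+ 2 + z ^+ 2) * (b - S * y / (3 * y ^+ 2 + z ^+ 2)) ^+ 2 +
    (3 * z ^+ 2 + w ^+ 2) * (c - S * z / (3 * z ^+ 2 + w ^+ 2)) ^+ 2 +
    (3 * w ^+ 2 + x ^+ 2) * (d - S * w / (3 * w ^+ 2 + x ^+ 2)) ^+ 2.
  by rewrite !addr_ge0 // mulr_ge0 ?sqr_ge0 // ltW.
have -> : (3 * x ^+ 2 + y ^+ 2) * (a - S * x / (3 * x ^+ 2 + y ^+ 2)) ^+ 2 +
    (3 * y ^+ 2 + z ^+ 2) * (b - S * y / (3 * y ^+ 2 + z ^+ 2)) ^+ 2 +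
    (3 * z ^+ 2 + w ^+ 2) * (c - S * z / (3 * z ^+ 2 + w ^+ 2)) ^+ 2 +
    (3 * w ^+ 2 + x ^+ 2) * (d - S * w / (3 * w ^+ 2 + x ^+ 2)) ^+ 2 =
    a ^+ 2 * (3 * x ^+ 2 + y ^+ 2) + b ^+ 2 * (3 * y ^+ 2 + z ^+ 2) +
    c ^+ 2 * (3 * z ^+ 2 + w ^+ 2) + d ^+ 2 * (3 * w ^+ 2 + x ^+ 2)
    - 2 * S * (a * x + b * y + c * z + d * w) + S ^+ 2 * q.
  by rewrite /q; field; rewrite !gt_eqF.
rewrite -/S; have := ler_wpM2l (sqr_ge0 S) q1; rewrite mulr1; lra.
Qed.

End RealInequality.

(** * Positivity and extremality for [k = 1], and the reversal to [k = 3] *)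

Section Positivity.
Variable R : realType.
Local Notation C := R[i].

Lemma psd_diag_ge0 n (A : 'M[C]_n) i : psd A -> 0 <= A i i.
Proof. by case=> _ /(_ (delta_mx i 0)); rewrite form_delta. Qed.

(** The form at [A_jj e_i - A_ji e_j] is [A_jj] times the 2 by 2 minor. If [A_jj = 0], then [e_j]
    lies in the kernel and [A_ij = 0]. *)
Lemma psd_minor2 n (A : 'M[C]_n) i j : psd A -> `|A i j| ^+ 2 <= A i i * A j j.
Proof.
move=> pA; have := psd_diag_ge0 j pA; rewrite le0r => /orP[/eqP aj|aj].
  have : A *m delta_mx j 0 = 0 :> 'cV_n by apply: psd_ker => //; rewrite form_delta.
  rewrite -colE => /matrixP/(_ i 0); rewrite !mxE => ->.
  by rewrite normr0 expr0n aj mulr0.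
have e p q : ((delta_mx 0 p : 'rV[C]_n) *m A *m (delta_mx q 0 : 'cV[C]_n)) 0 0 = A p q.
  by rewrite -colE -rowE !mxE.
have ac : (A j j)^* = A j j by rewrite psd_conj.
rewrite -subr_ge0 -(pmulr_rge0 _ aj) normCK psd_conj //.
have [_ /(_ (A j j *: delta_mx i 0 - A j i *: delta_mx j 0))] := pA.
congr (0 <= _).
rewrite -scaleNr adjmxD !adjmxZ !adjmx_delta rmorphN /= ac psd_conj //.
rewrite !mulmxDl !mulmxDr.
rewrite -?(@scalemxAr C) -?(@scalemxAl C).
move: (e i i) (e i j) (e j i) (e j j).
move: (delta_mx 0 _ *m A *m delta_mx _ 0) (delta_mx 0 _ *m A *m delta_mx _ 0).
move: (delta_mx 0 _ *m A *m delta_mx _ 0) (delta_mx 0 _ *m A *m delta_mx _ 0).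
by move=> M1 M2 M3 M4 h1 h2 h3 h4; rewrite !mxE h1 h2 h3 h4; ring.
Qed.

Lemma cyclic_quarticC (t r : 'I_4 -> C) :
  (forall i, 0 <= t i) -> (forall i, 0 <= r i) ->
  (\sum_i t i * r i) ^+ 2 <=
  \sum_i t i ^+ 2 * (3 * r i ^+ 2 + r (sigma 1 i) ^+ 2).
Proof.
move=> t0 r0; pose r' i := complex.Re (r i); pose t' i := complex.Re (t i).
have rE i : r i = (r' i)%:C%C by rewrite RRe_real // ger0_real.
have tE i : t i = (t' i)%:C%C by rewrite RRe_real // ger0_real.
have r'0 i : 0 <= r' i by rewrite -lecR -rE.
clearbody r' t'; rewrite !sum4 !sigma1E !rE !tE.
have := cyclic_quartic (t' o0) (t' o1) (t' o2) (t' o3)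
  (r'0 o0) (r'0 o1) (r'0 o2) (r'0 o3).
rewrite -lecR !(rmorphD, rmorphM, rmorphXn) /= rmorph1.
by congr (_ <= _); ring.
Qed.

Lemma psd_form_le n (A : 'M[C]_n) (v : 'cV[C]_n) : psd A ->
  (adjmx v *m A *m v) 0 0 <= (\sum_i `|v i 0| * sqrtC (A i i)) ^+ 2.
Proof.
move=> pA; have [_ /(_ v)/ger0_norm <-] := pA.
rewrite formE expr2 mulr_suml (le_trans (ler_norm_sum _ _ _)) //.
apply: ler_sum => k _; rewrite mulr_sumr (le_trans (ler_norm_sum _ _ _)) //.
apply: ler_sum => l _; rewrite !normrM norm_conjC.
have -> : `|v k 0| * sqrtC (A k k) * (`|v l 0| * sqrtC (A l l)) =
  `|v k 0| * (sqrtC (A k k) * sqrtC (A l l)) * `|v l 0| by ring.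
rewrite ler_wpM2r // ler_wpM2l // -(@ler_pXn2r _ 2) // ?nnegrE ?mulr_ge0 //.
- by rewrite exprMn !sqrtCK psd_minor2.
- by rewrite sqrtC_ge0 psd_diag_ge0.
- by rewrite sqrtC_ge0 psd_diag_ge0.
Qed.

Lemma Phi4_1_positive : positive_map (@Phi4 R 1).
Proof.
split=> [|A pA]; first exact: Phi4_linear.
have ac i : (A i i)^* = A i i by exact: psd_conj.
split=> [|v].
  apply/matrixP => i j; rewrite adjmxE !Phi4E rmorphB /= (psd_conj _ _ pA).
  rewrite rmorphMn /= rmorphD rmorphM /= !ac rmorph_nat eq_sym.
  by have [->|_] := eqVneq i j.
(* Diagonal entries are written as squares of their roots, the shape required by
   [cyclic_quarticC]. *)
have -> : (adjmx v *m Phi4 1 A *m v) 0 0 =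
    \sum_i `|v i 0| ^+ 2 *
      (3 * sqrtC (A i i) ^+ 2 + sqrtC (A (sigma 1 i) (sigma 1 i)) ^+ 2)
    - (adjmx v *m A *m v) 0 0.
  rewrite !formE -sumrB; apply: eq_bigr => k _.
  rewrite -[X in X - _](sum_kron k) -sumrB; apply: eq_bigr => l _.
  rewrite Phi4E !sqrtCK normCK; have [<-|_] := eqVneq k l; last by rewrite !mulr0n; ring.
  by rewrite !mulr1n; ring.
rewrite subr_ge0 (le_trans (psd_form_le _ pA)) //.
rewrite (cyclic_quarticC (t := fun i => `|v i 0|) (r := fun i => sqrtC (A i i))) //.
by move=> i; rewrite sqrtC_ge0 psd_diag_ge0.
Qed.

Lemma Phi4_1_extremal : extremal_map (@Phi4 R 1).
Proof.
split=> [|f1 f2 p1 p2 fE]; first exact: Phi4_1_positive.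
have [l1 l10 h1] := summand_proportional p1 p2 fE.
have [|l2 l20 h2] := summand_proportional p2 p1; first by move=> A; rewrite addrC.
by exists l1, l2.
Qed.

Definition rev_mx (A : 'M[C]_4) : 'M[C]_4 := \matrix_(i, j) A (rev_ord i) (rev_ord j).

Lemma rev_mxK : involutive rev_mx.
Proof. by move=> A; apply/matrixP => i j; rewrite !mxE !rev_ordK. Qed.

Lemma rev_mx_positive : positive_map rev_mx.
Proof.
split=> [a A B|A pA]; first by apply/matrixP => i j; rewrite !mxE.
split=> [|v]; first by apply/matrixP => i j; rewrite adjmxE !mxE psd_conj.
have [_ /(_ (\col_i v (rev_ord i) 0))] := pA.
rewrite !formE (reindex_inj rev_ord_inj) /=; congr (0 <= _).
apply: eq_bigr => k _; rewrite (reindex_inj rev_ord_inj) /=.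
by apply: eq_bigr => l _; rewrite !mxE !rev_ordK.
Qed.

(** Reversing the indices turns the shift by 1 into the shift by -1, which is 3 modulo 4. *)
Lemma Phi4_3E A : @Phi4 R 3 A = rev_mx (Phi4 1 (rev_mx A)).
Proof.
have sr i : rev_ord (sigma 1 (rev_ord i)) = sigma 3 i.
  by apply: val_inj; elim/ord4_ind: i; rewrite /sigma /= !inordK.
apply/matrixP => i j; rewrite [RHS]mxE !Phi4E !mxE !rev_ordK sr.
by rewrite (inj_eq rev_ord_inj).
Qed.

End Positivity.

(** * A decomposition into positive maps for [k = 2] *)

Section NonExtremal.
Variable R : realType.
Local Notation C := R[i].

Lemma positive_mapD n (f g : 'M[C]_n -> 'M[C]_n) :
  positive_map f -> positive_map g -> positive_map (fun A => f A + g A).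
Proof.
move=> [lf pf] [lg pg]; split=> [a A B|A pA]; last exact: psdD (pf _ pA) (pg _ pA).
by rewrite lf lg scalerDr addrACA.
Qed.

Lemma sandwich_positive n (V : 'M[C]_n) : positive_map (fun A => V *m A *m adjmx V).
Proof.
split=> [a A B|A]; last exact: psd_sandwich.
by rewrite mulmxDr mulmxDl -(@scalemxAr C) -(@scalemxAl C).
Qed.

Lemma sandwich_tr_positive n (V : 'M[C]_n) : positive_map (fun A => V *m A^T *m adjmx V).
Proof.
have [l p] := sandwich_positive V.
by split=> [a A B|A /psd_tr/p//]; rewrite linearD linearZ l.
Qed.

(** With at most one nonzero entry per row, each entry of a sandwich is a single term. *)
Definition monomial_mx n (v : 'I_n -> C) (s : 'I_n -> 'I_n) : 'M[C]_n :=
  \matrix_(i, j) (v i *+ (s i == j)).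

Lemma sandwich_monomialE n (v : 'I_n -> C) (s : 'I_n -> 'I_n) (A : 'M[C]_n) i j :
  (monomial_mx v s *m A *m adjmx (monomial_mx v s)) i j = v i * A (s i) (s j) * (v j)^*.
Proof.
rewrite mxE -[RHS](sum_kron (s j)); apply: eq_bigr => l _.
rewrite adjmxE !mxE rmorphMn mulrnAr; case: eqP => // <-; congr (_ * _ *+ _).
rewrite -[RHS](sum_kron (s i)); apply: eq_bigr => k _.
by rewrite mxE mulrnAl; case: eqP => [->|].
Qed.

Definition edge (i j k : 'I_4) : C := (k == i)%:R - (k == j)%:R.
(* Only the values at [i] and [j] matter: [edge i j] vanishes elsewhere. *)
Definition swap (i j k : 'I_4) : 'I_4 := if k == i then j else i.

(** For [i != j] the outer factor is [E_ij - E_ji]. *)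
Definition skew_map i j (A : 'M[C]_4) :=
  monomial_mx (edge i j) (swap i j) *m A^T *m adjmx (monomial_mx (edge i j) (swap i j)).
Definition edge_map i j (A : 'M[C]_4) :=
  monomial_mx (edge i j) id *m A *m adjmx (monomial_mx (edge i j) id).

(* The diagonal matrices of the edges of the 4-cycle sum to the Schur
   multiplier by its graph Laplacian. *)
Definition rest_map (A : 'M[C]_4) := skew_map o1 o3 A +
  (edge_map o0 o1 A + (edge_map o1 o2 A + (edge_map o2 o3 A + edge_map o3 o0 A))).

Lemma rest_map_positive : positive_map rest_map.
Proof.
apply: positive_mapD; first exact: sandwich_tr_positive.
do 3 (apply: positive_mapD; first exact: sandwich_positive).
exact: sandwich_positive.
Qed.

Lemma Phi4_2E A : @Phi4 R 2 A = skew_map o0 o2 A + rest_map A.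
Proof.
apply/matrixP => i j; rewrite Phi4E.
have addE (B D : 'M[C]_4) p q : (B + D) p q = B p q + D p q by rewrite mxE.
rewrite /rest_map !addE !sandwich_monomialE /edge /swap.
rewrite !rmorphB !rmorph_nat /=.
by elim/ord4_ind: i; elim/ord4_ind: j; rewrite ?sigma2E /= ?mxE ?mulr1n ?mulr0n; ring.
Qed.

(** At [E_11] the (1, 1) entry of [skew_map o0 o2] is 0 while that of [Phi4 2] is 2, so [l1 = 0];
    yet at [E_00] the (2, 2) entry of [skew_map o0 o2] is 1. *)
Lemma Phi4_2_not_extremal : ~ extremal_map (@Phi4 R 2).
Proof.
case=> _ /(_ _ _ (sandwich_tr_positive _) rest_map_positive Phi4_2E)[l1 [l2 [_ _ h _]]].
have := h (delta_mx o1 o1) => /matrixP/(_ o1 o1).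
rewrite sandwich_monomialE /edge /= subrr !mul0r mxE Phi4E !mxE sigma2E /=.
rewrite addr0 mulr1 mulr1n => /esym/eqP; rewrite mulf_eq0 => /orP[/eqP l0|]; last first.
  by rewrite (_ : 3 - 1 = 2 :> C) ?pnatr_eq0 //; ring.
have := h (delta_mx o0 o0) => /matrixP/(_ o2 o2).
rewrite sandwich_monomialE /edge /swap l0 scale0r !mxE /= => /eqP.
by rewrite rmorph0 rmorph1 (_ : _ * _ = 1) ?oner_eq0 //; ring.
Qed.

End NonExtremal.

Theorem theorem3 (R : realType) (k : nat) :
  (1 <= k <= 3)%N ->
  (extremal_map (@Phi4 R k) <-> k = 1%N \/ k = 3%N).
Proof.
case: k => [|[|[|[|]]]] // _; split; try by [left|right].
- by move=> _; apply: Phi4_1_extremal.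
- by move/Phi4_2_not_extremal.
- by case.
move=> _; apply: extremal_conj (@Phi4_3E R) _; last exact: Phi4_1_extremal.
  exact: rev_mx_positive.
exact: rev_mxK.
Qed.
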